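(* Let $\mathcal G,\mathcal H$ be Lie groups with Lie algebras $\mathfrak g,\mathfrak h$, let $\Phi:\mathcal G\to\mathrm{Aut}(\mathcal H)$ be an action of the Lie group $\mathcal G$ on $\mathcal H$, let $D:\mathcal G\to\mathcal H$ be a crossed homomorphism on the Lie group $\mathcal G$ with respect to $\Phi$, and let $d=D_{*e}:\mathfrak g\to\mathfrak h$. Then $$(\Phi_D)_*=\phi_d .$$ Moreover, the differentiation (at the identity) of the derived Lie group crossed homomorphism $\overline D$ is exactly the derived Lie algebra crossed homomorphism $-d$.
   Context: The action $\Phi$ is a smooth action of $\mathcal G$ on $\mathcal H$ by Lie group automorphisms. A crossed homomorphism on the Lie group $\mathcal G$ with respect to $\Phi$ is a smooth map $D:\mathcal G\to\mathcal H$ with $D(gh)=D(g)\Phi(g)(D(h))$ for all $g,h\in\mathcal G$. The derived action $\Phi_D:\mathcal G\to\mathrm{Aut}(\mathcal H)$ is $\Phi_D(g)(h)=D(g)\Phi(g)(h)D(g)^{-1}$ for $g\in\mathcal G,h\in\mathcal H$, and the derived crossed homomorphism is $\overline D:\mathcal G\to\mathcal H$, $\overline D(g)=D(g)^{-1}$, which is a crossed homomorphism with respect to $\Phi_D$. Any smooth action $\Psi:\mathcal G\to\mathrm{Aut}(\mathcal H)$ differentiates to a Lie algebra action $\Psi_*:\mathfrak g\to\mathrm{Der}(\mathfrak h)$: differentiating each $\Psi(g)$ at the identity $e_{\mathcal H}$ gives a Lie group homomorphism $\mathcal G\to\mathrm{Aut}(\mathfrak h)$, and $\Psi_*$ is the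 differential of this homomorphism at $e$; i.e. $\Psi_*(x)(u)=\frac{d^2}{dt\,ds}\big|_{t,s=0}\Psi(\exp_{\mathcal G}(tx))(\exp_{\mathcal H}(su))$. Let $\phi=\Phi_*:\mathfrak g\to\mathrm{Der}(\mathfrak h)$. The map $d=D_{*e}$ is a Lie algebra crossed homomorphism with respect to $\phi$, i.e. $d([x,y]_{\mathfrak g})=\phi(x)(d(y))-\phi(y)(d(x))+[d(x),d(y)]_{\mathfrak h}$. The derived Lie algebra action is $\phi_d:\mathfrak g\to\mathrm{Der}(\mathfrak h)$, $\phi_d(x)(u)=\phi(x)(u)+[d(x),u]_{\mathfrak h}$, and $-d$ is the derived Lie algebra crossed homomorphism, with respect to $\phi_d$. *)

(* Defs.v *)
From HB Require Import structures.
From mathcomp Require Import all_boot all_order all_algebra.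
From mathcomp Require Import all_classical all_reals all_analysis.
Import numFieldNormedType.Exports.

Set Implicit Arguments.
Unset Strict Implicit.
Unset Printing Implicit Defensive.

Local Open Scope classical_set_scope.
Local Open Scope ring_scope.

(* A real Lie group of dimension n is a (Hausdorff, second countable) smooth
   manifold modelled on 'rV[R]_n carrying a MathComp groupType structure with
   smooth operations. *)

(* Only meaningful for U open: 'd f x looks at f on a full neighbourhood of x.
   The model spaces are finite-dimensional, so continuity of x |-> 'd f x v for
   every v is continuity of x |-> 'd f x. *)
Fixpoint Ck (R : realType) (E F : normedModType R) (k : nat) (U : set E)
    (f : E -> F) : Prop :=
  if k is k'.+1 then
    (forall x, U x -> differentiable f x) /\
    (forall v : E, Ck k' U (fun x => 'd f x v))
  else forall x, U x -> {for x, continuous f}.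

Definition smooth_on (R : realType) (E F : normedModType R) (U : set E)
  (f : E -> F) : Prop := forall k, Ck k U f.

(* chart_map is relevant on chart_dom only, and chart_inv on chart_img only. *)
Record chart (R : realType) (E : normedModType R) (M : topologicalType) :=
  Chart {
    chart_dom : set M;
    chart_map : M -> E;
    chart_inv : E -> M }.

Definition chart_img (R : realType) (E : normedModType R) (M : topologicalType)
  (c : chart E M) : set E := chart_map c @` chart_dom c.

Record is_chart (R : realType) (E : normedModType R) (M : topologicalType)
    (c : chart E M) : Prop := IsChart {
  chart_dom_open : open (chart_dom c);
  chart_img_open : open (chart_img c);
  chart_mapK : {in chart_dom c, cancel (chart_map c) (chart_inv c)};
  chart_map_continuous : {in chart_dom c, continuous (chart_map c)};
  chart_inv_continuous : {in chart_img c, continuous (chart_inv c)} }.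

Definition prod_chart (R : realType) (E F : normedModType R)
    (M N : topologicalType) (c : chart E M) (d : chart F N) :
    chart (E * F)%type (M * N)%type :=
  Chart (chart_dom c `*` chart_dom d)
        (fun p => (chart_map c p.1, chart_map d p.2))
        (fun q => (chart_inv c q.1, chart_inv d q.2)).

Definition prod_atlas (R : realType) (E F : normedModType R)
    (M N : topologicalType) (A : set (chart E M)) (B : set (chart F N)) :
    set (chart (E * F)%type (M * N)%type) :=
  [set e | exists c d, [/\ A c, B d & e = prod_chart c d]].

Definition smooth_wrt (R : realType) (E F : normedModType R)
    (M N : topologicalType) (A : set (chart E M)) (B : set (chart F N))
    (f : M -> N) : Prop :=
  continuous f /\
  forall c d, A c -> B d ->
    smooth_on (chart_map c @` (chart_dom c `&` f @^-1` chart_dom d))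
              (chart_map d \o f \o chart_inv c).

(* The atlas need not be maximal. chart_at p is a chosen chart around p, used
   below to write tangent vectors at p in coordinates. *)
HB.mixin Record isManifold (R : realType) (n : nat) M of Topological M := {
  atlas : set (chart 'rV[R]_n M);
  atlas_chart : forall c, atlas c -> is_chart c;
  atlas_compatible : forall c c', atlas c -> atlas c' ->
    smooth_on (chart_map c @` (chart_dom c `&` chart_dom c'))
              (chart_map c' \o chart_inv c);
  chart_at : M -> chart 'rV[R]_n M;
  chart_at_atlas : forall p, atlas (chart_at p);
  chart_at_dom : forall p, chart_dom (chart_at p) p;
  manifold_hausdorff : hausdorff_space M;
  manifold_second_countable : @second_countable M }.

#[short(type="manifoldType")]
HB.structure Definition Manifold (R : realType) (n : nat) :=
  {M of Topological M & isManifold R n M}.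

Definition smooth (R : realType) (m n : nat) (M : manifoldType R m)
    (N : manifoldType R n) (f : M -> N) : Prop :=
  smooth_wrt (@atlas R m M) (@atlas R n N) f.

Definition smooth2 (R : realType) (m n p : nat) (M : manifoldType R m)
    (N : manifoldType R n) (P : manifoldType R p) (f : M -> N -> P) : Prop :=
  smooth_wrt (prod_atlas (@atlas R m M) (@atlas R n N)) (@atlas R p P)
    (fun z : M * N => f z.1 z.2).

HB.mixin Record isLieGroup (R : realType) (n : nat) G
    of Manifold R n G & Group G := {
  mulg_smooth : smooth2 (fun g h : G => (g * h)%g);
  invg_smooth : smooth (fun g : G => (g^-1)%g) }.

#[short(type="lieGroupType")]
HB.structure Definition LieGroup (R : realType) (n : nat) :=
  {G of Manifold R n G & Group G & isLieGroup R n G}.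

(* The tangent space T_p M is represented by 'rV[R]_n, which the differential
   of chart_at p identifies with it; in particular the Lie algebra T_1 G of a Lie
   group G of dimension n has 'rV[R]_n as underlying space. *)

Definition at_coord (R : realType) (n : nat) (M : manifoldType R n) (p : M)
  : 'rV[R]_n := chart_map (chart_at p) p.

(* The differential f_{*p} : T_p M -> T_(f p) N. *)
Definition mdiff (R : realType) (m n : nat) (M : manifoldType R m)
    (N : manifoldType R n) (f : M -> N) (p : M) : 'rV[R]_m -> 'rV[R]_n :=
  'd (chart_map (chart_at (f p)) \o f \o chart_inv (chart_at p)) (at_coord p).

(* The differential at p of a map with values in a vector space V, where
   T_(f p) V = V. *)
Definition vdiff (R : realType) (m : nat) (M : manifoldType R m)
    (V : normedModType R) (f : M -> V) (p : M) : 'rV[R]_m -> V :=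
  'd (f \o chart_inv (chart_at p)) (at_coord p).

(* vector_field M stands for the sections X of TM: X p belongs to T_p M, so it
   is written in the chart chart_at p, which varies with p. *)
Definition vector_field (R : realType) (n : nat) (M : manifoldType R n) :=
  M -> 'rV[R]_n.

(* The expression of X in the single chart chart_at p. *)
Definition vf_coord (R : realType) (n : nat) (M : manifoldType R n)
    (X : vector_field M) (p : M) : 'rV[R]_n -> 'rV[R]_n :=
  fun a => let q := chart_inv (chart_at p) a in
    vdiff (chart_map (chart_at p)) q (X q).

(* Sign convention: [X, Y] is the commutator X Y - Y X of derivations. *)
Definition vf_bracket (R : realType) (n : nat) (M : manifoldType R n)
    (X Y : vector_field M) : vector_field M :=
  fun p => 'd (vf_coord Y p) (at_coord p) (vf_coord X p (at_coord p))
         - 'd (vf_coord X p) (at_coord p) (vf_coord Y p (at_coord p)).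

Definition left_invariant_field (R : realType) (n : nat) (G : lieGroupType R n)
    (x : 'rV[R]_n) : vector_field G :=
  fun g => mdiff (fun h : G => (g * h)%g) 1%g x.
Arguments left_invariant_field {R n} G x.

Definition lie_bracket (R : realType) (n : nat) (G : lieGroupType R n)
    (x y : 'rV[R]_n) : 'rV[R]_n :=
  vf_bracket (left_invariant_field G x) (left_invariant_field G y) 1%g.

Definition lie_automorphism (R : realType) (n : nat) (H : lieGroupType R n)
    (f : H -> H) : Prop :=
  [/\ {morph f : x y / (x * y)%g}, smooth f &
      exists2 f' : H -> H, cancel f f' /\ cancel f' f & smooth f'].

Record lie_action (R : realType) (m n : nat) (G : lieGroupType R m)
    (H : lieGroupType R n) (Phi : G -> H -> H) : Prop := LieAction {
  lie_action_aut : forall g, lie_automorphism (Phi g);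
  lie_action1 : forall h, Phi 1%g h = h;
  lie_actionM : forall g g' h, Phi (g * g')%g h = Phi g (Phi g' h);
  lie_action_smooth : smooth2 Phi }.

Definition crossed_hom (R : realType) (m n : nat) (G : lieGroupType R m)
    (H : lieGroupType R n) (Phi : G -> H -> H) (D : G -> H) : Prop :=
  smooth D /\ forall g h, D (g * h)%g = (D g * Phi g (D h))%g.

Definition derived_action (R : realType) (m n : nat) (G : lieGroupType R m)
    (H : lieGroupType R n) (Phi : G -> H -> H) (D : G -> H) : G -> H -> H :=
  fun g h => (D g * Phi g h * (D g)^-1)%g.

Definition derived_crossed_hom (R : realType) (m n : nat)
    (G : lieGroupType R m) (H : lieGroupType R n) (D : G -> H) : G -> H :=
  fun g => ((D g)^-1)%g.

(* The homomorphism g |-> Psi(g)_{*1} from G to Aut(Lie H); endomorphisms of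
   'rV[R]_n are encoded as matrices acting on row vectors on the right. *)
Definition tangent_action (R : realType) (m n : nat) (G : lieGroupType R m)
    (H : lieGroupType R n) (Psi : G -> H -> H) : G -> 'M[R]_n :=
  fun g => lin1_mx (mdiff (Psi g) 1%g).

(* Psi_*, the differential at 1 of tangent_action Psi. *)
Definition diff_action (R : realType) (m n : nat) (G : lieGroupType R m)
    (H : lieGroupType R n) (Psi : G -> H -> H)
    (x : 'rV[R]_m) (u : 'rV[R]_n) : 'rV[R]_n :=
  u *m vdiff (tangent_action Psi) 1%g x.

Definition derived_lie_action (R : realType) (m n : nat)
    (H : lieGroupType R n) (phi : 'rV[R]_m -> 'rV[R]_n -> 'rV[R]_n)
    (d : 'rV[R]_m -> 'rV[R]_n) : 'rV[R]_m -> 'rV[R]_n -> 'rV[R]_n :=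
  fun x u => phi x u + lie_bracket H (d x) u.

Definition derived_lie_crossed_hom (R : realType) (m n : nat)
    (d : 'rV[R]_m -> 'rV[R]_n) : 'rV[R]_m -> 'rV[R]_n :=
  fun x => - d x.

(* Main.v *)
From HB Require Import structures.
Require Import Defs.
From mathcomp Require Import all_boot all_order all_algebra.
From mathcomp Require Import all_classical all_reals all_analysis.
From mathcomp Require Import ring.
Import Order.TTheory GRing.Theory Num.Theory.
Import numFieldNormedType.Exports.

(** Write Phi_D(g) = c_(D g) o Phi(g), where c_k is conjugation by k. All these
    automorphisms of H fix the unit, and on the tangent space there the matrix of
    Phi_D(g) is the product of those of Phi(g) and of Ad(D g). Differentiating
    this product at g = 1, where both factors are the identity because D(1) = 1,
    gives phi(x) u + ad(d x) u. What remains is that the differential of Ad is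
    the bracket of left invariant fields.

    The computation takes place in the distinguished charts at the units, in
    which the multiplication of H becomes a map mu near (e, e) satisfying
    mu(s, e) = s and mu(e, t) = t. Splitting conjugation by k into left
    multiplication by k and right multiplication by k^-1 avoids differentiating
    a composite twice: the tangent map of the first is d mu(k, e)(0, .), that of
    the second d mu(k, k^-1)(., 0) (lemma [derived_action_tangent]), so only
    second derivatives of mu at (e, e) occur. Write B(p; q) for the derivative
    in the direction p of z |-> d mu(z) q at (e, e). With y = d x, the path
    k = D g moves (k, e) by (y, 0) and (k, k^-1) by (y, -y), whence

      ad(y) u = B((y, 0); (0, u)) + B((y, -y); (u, 0)).

    Here B((y, 0); (u, 0)) = 0 because mu(s, e) = s, and the symmetry of second
    derivatives ([diff_diffC_rV]) turns - B((0, y); (u, 0)) into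
    - B((u, 0); (0, y)). On the other side, the left invariant field extending u
    reads s |-> d mu(s, e)(0, u) in the chart ([left_invariant_coord]), so
    that [y, u] = B((y, 0); (0, u)) - B((u, 0); (0, y)): the two expressions
    agree.

    The last claim is the chain rule together with the fact that inversion has
    differential -id at the unit. *)

Set Implicit Arguments.
Unset Strict Implicit.
Unset Printing Implicit Defensive.
Local Open Scope classical_set_scope.
Local Open Scope ring_scope.

(** * Germs of differentials, and symmetry of second derivatives *)

Section Analysis.
Context {R : realType}.
Implicit Types E F : normedModType R.

(** The differential is determined by the germ of the function at the point. All
    the later identities in charts hold only near a point and rest on this. *)
Lemma is_diff_near_eq E F (f g df : E -> F) x :
  (\near x, f x = g x) -> is_diff x f df -> is_diff x g df.
Proof.
move=> fg [fx <-].
have fgx : f x = g x := nbhs_singleton fg.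
have /diff_locallyP[dfc dfo] := fx.
have gloc : g \o shift x = cst (g x) + 'd f x +o_ 0 id.
  apply/eqaddoP => e e0; move/eqaddoP: dfo => /(_ e e0) dfo.
  have fg0 : \forall h \near (0 : E), f (h + x) = g (h + x).
    by move: fg; rewrite (near_shift 0) subr0 => fg; apply: filterS fg.
  apply: filterS2 dfo fg0 => h /=.
  by rewrite fgx !fctE /= => + <-.
have dgf : 'd g x = 'd f x :> (E -> F) by exact: diff_unique.
have gx : differentiable g x by apply/diff_locallyP; rewrite dgf.
by apply: DiffDef; [exact: gx|exact: dgf].
Qed.

Lemma diff_near_eq E F (f g : E -> F) x : (\near x, f x = g x) ->
  differentiable f x -> 'd g x = 'd f x :> (E -> F).
Proof.
by move=> fg /differentiableP fx; have [_] := is_diff_near_eq fg fx.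
Qed.

(** For fixed t, the second difference is the increment over [0, t] of
    s |-> f (x + s u + t v) - f (x + s u). By the mean value theorem it is t times
    G (x + c u + t v) - G (x + c u) for some c in ]0, t[, where G z is the
    derivative of f at z along u, and the differentiability of G at x estimates
    this as t times the derivative of G along v, up to o(t). *)
Lemma second_difference E (f : E -> R) x u v :
  (\forall z \near x, differentiable f z) ->
  differentiable (fun z => 'd f z u) x ->
  forall e, 0 < e -> \forall t \near 0^'+,
    `|(f (x + t *: u + t *: v) - f (x + t *: u) - f (x + t *: v) + f x)
      - t ^+ 2 * 'd (fun z => 'd f z u) x v| <= e * t ^+ 2.
Proof.
move=> fx Gx e e0.
set G := fun z => 'd f z u.
pose K := `|u| + `|v| + 1.
have K0 : 0 < K by rewrite /K ltr_wpDl// addr_ge0.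
(* The increments c u + t v and c u have norm at most t K; an error of e / (2 K)
   per unit of norm at each of them adds up to e t. *)
have e'0 : 0 < e / (2 * K) by rewrite divr_gt0// mulr_gt0.
have Go : \forall h \near (0 : E),
    `|G (h + x) - (G x + 'd G x h)| <= e / (2 * K) * `|h|.
  by have /diff_locallyP[_ /eqaddoP /(_ _ e'0)] := Gx.
have fx0 : \forall h \near (0 : E), differentiable f (h + x).
  by move: fx; rewrite (near_shift 0) subr0 => fx; apply: filterS fx.
have /nbhs_ballP[r /= r0 rP] : \forall h \near (0 : E),
    `|G (h + x) - (G x + 'd G x h)| <= e / (2 * K) * `|h| /\
    differentiable f (h + x) by exact: filterI.
near=> t.
have t0 : 0 < t by [].
have tK : t * K < r.
  by rewrite -ltr_pdivlMr//; near: t; apply: nbhs_right_lt; rewrite divr_gt0.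
have small s k : 0 <= s <= t -> 0 <= k <= t -> `|s *: u + k *: v| <= t * K.
  move=> /andP[s0 st] /andP[k0 kt].
  rewrite (le_trans (ler_normD _ _))// !normrZ !ger0_norm//.
  rewrite /K !mulrDr mulr1 -addrA lerD ?ler_wpM2r// ler_wpDr ?(ltW t0)//.
  by rewrite ler_wpM2r.
have inball s k : 0 <= s <= t -> 0 <= k <= t -> ball (0 : E) r (s *: u + k *: v).
  move=> sP kP; rewrite -ball_normE /= sub0r normrN.
  exact: le_lt_trans (small _ _ sP kP) tK.
have tt : 0 <= t <= t by apply/andP; split; [exact: ltW|exact: lexx].
have zt : (0 : R) <= 0 <= t by apply/andP; split; [exact: lexx|exact: ltW].
pose line k (s : R) := s *: u + (k *: v + x).
have lineD k s : is_diff s (line k) ( *:%R^~ u).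
  have -> : line k = ( *:%R^~ u) + cst (k *: v + x) by [].
  rewrite -[X in is_diff_def _ _ X]addr0.
  exact: is_diffD.
have der k s : 0 <= s <= t -> 0 <= k <= t ->
    is_derive s 1 (f \o line k) (G (line k s)).
  move=> sP kP.
  have [_] := rP _ (inball s k sP kP).
  rewrite -addrA -/(line k s) => dfl.
  have dfl' : is_diff s (f \o line k) ('d f (line k s) \o ( *:%R^~ u)).
    exact: (is_diff_comp (lineD k s) (differentiableP dfl)).
  have [dl dlE] := dfl'.
  apply: DeriveDef; first exact: diff_derivable.
  by rewrite deriveE// dlE /= scale1r.
pose phi s := f (line t s) - f (line 0 s).
have phider s : 0 <= s <= t -> is_derive s 1 phi (G (line t s) - G (line 0 s)).
  move=> sP; apply: (@is_deriveB _ _ _ (f \o line t) (f \o line 0)).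
    exact: der.
  exact: der.
have [c cP phiE] : exists2 c, c \in `]0, t[%R &
    phi t - phi 0 = (G (line t c) - G (line 0 c)) * (t - 0).
  apply: (@MVT _ phi (fun s => G (line t s) - G (line 0 s)) 0 t t0).
    move=> s; rewrite in_itv/= => /andP[s0 st]; apply: phider.
    by rewrite !ltW.
  apply: derivable_within_continuous => s; rewrite in_itv/= => sP.
  by have [] := phider s sP.
have {}cP : 0 <= c <= t by move: cP; rewrite in_itv/= => /andP[? ?]; rewrite !ltW.
have -> : f (x + t *: u + t *: v) - f (x + t *: u) - f (x + t *: v) + f x
    = phi t - phi 0.
  have e1 : line t t = x + t *: u + t *: v by rewrite /line addrA [LHS]addrC addrA.
  have e2 : line 0 t = x + t *: u by rewrite /line scale0r add0r addrC.
  have e3 : line t 0 = x + t *: v by rewrite /line scale0r add0r addrC.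
  have e4 : line 0 0 = x by rewrite /line !scale0r !add0r.
  by rewrite /phi e1 e2 e3 e4 opprB addrA addrAC.
rewrite phiE subr0.
have [+ _] := rP _ (inball c t cP tt).
have [+ _] := rP _ (inball c 0 cP zt).
rewrite -!addrA -/(line t c) -/(line 0 c).
rewrite !opprD !addrA.
set g0 := G (line 0 c); set g1 := G (line t c).
rewrite scale0r addr0 => h0 h1.
have {}h0 := le_trans h0 (ler_wpM2l (ltW e'0) _).
have {}h1 := le_trans h1 (ler_wpM2l (ltW e'0) (small c t cP tt)).
have {}h0 : `|g0 - G x - 'd G x (c *: u)| <= e / (2 * K) * (t * K).
  by apply: h0; have := small c 0 cP zt; rewrite scale0r addr0.
rewrite linearD in h1.
have ee : e / (2 * K) * (t * K) = e / 2 * t.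
  by field; rewrite gt_eqF.
have -> : (g1 - g0) * t - t ^+ 2 * 'd G x v =
  t * ((g1 - G x - ('d G x (c *: u) + 'd G x (t *: v)))
       - (g0 - G x - 'd G x (c *: u))).
  rewrite [X in _ = t * (_ - (_ + X) - _)]linearZ/= /GRing.scale/=; ring.
rewrite normrM (gtr0_norm t0) mulrC expr2 mulrA ler_pM2r//.
apply: (le_trans (ler_normB _ _)).
rewrite [e](splitr e) mulrDl lerD//.
  by rewrite -ee.
by rewrite -ee.
Unshelve. all: by end_near. Qed.

(** The second difference is symmetric in u and v, so t^2 times either iterated
    derivative approximates it up to o(t^2); dividing by t^2 gives equality. *)
Lemma diff_diffC E (f : E -> R) x u v :
  (\forall z \near x, differentiable f z) ->
  differentiable (fun z => 'd f z u) x ->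
  differentiable (fun z => 'd f z v) x ->
  'd (fun z => 'd f z u) x v = 'd (fun z => 'd f z v) x u.
Proof.
move=> fx fu fv; apply/eqP; rewrite -subr_eq0 -normr_le0; apply/ler_addgt0Pl.
move=> e e0; rewrite addr0.
have e20 : 0 < e / 2 by rewrite divr_gt0.
near (0 : R)^'+ => t.
have t0 : 0 < t by [].
have huv : `|(f (x + t *: u + t *: v) - f (x + t *: u) - f (x + t *: v) + f x)
      - t ^+ 2 * 'd (fun z => 'd f z u) x v| <= e / 2 * t ^+ 2.
  by near: t; exact: second_difference.
have hvu : `|(f (x + t *: v + t *: u) - f (x + t *: v) - f (x + t *: u) + f x)
      - t ^+ 2 * 'd (fun z => 'd f z v) x u| <= e / 2 * t ^+ 2.
  by near: t; exact: second_difference.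
have t20 : 0 < t ^+ 2 by rewrite exprn_gt0.
rewrite -(ler_pM2r t20) -{1}(gtr0_norm t20) -normrM.
set A := 'd _ _ _ in huv *; set B := 'd _ _ _ in hvu *.
move: hvu; rewrite (addrAC x) (addrAC (f _)) => hvu.
set D := _ - _ + f x in huv hvu.
have -> : (A - B) * t ^+ 2 = (D - t ^+ 2 * B) - (D - t ^+ 2 * A) by ring.
apply: (le_trans (ler_normB _ _)).
by rewrite [e](splitr e) mulrDl lerD.
Unshelve. all: by end_near. Qed.

(** * Matrix-valued functions *)

Lemma is_diff_sum E F (I : finType) (f df : I -> E -> F) x :
  (forall i, is_diff x (f i) (df i)) ->
  is_diff x (fun z => \sum_i f i z) (fun h => \sum_i df i h).
Proof.
move=> fdf.
have -> : (fun z => \sum_i f i z) = \sum_i f i by apply/funext => z; rewrite fct_sumE.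
have -> : (fun z => \sum_i df i z) = \sum_i df i.
  by apply/funext => z; rewrite fct_sumE.
apply: (big_ind2 (fun g dg : E -> F => is_diff x g dg)).
- exact: is_diff_cst.
- by move=> g1 dg1 g2 dg2; exact: is_diffD.
- by move=> i _; exact: fdf.
Qed.

Lemma is_diffZl E F (k dk : E -> R) (w : F) x :
  is_diff x k dk -> is_diff x (fun z => k z *: w) (fun h => dk h *: w).
Proof.
move=> [kx <-]; apply: DiffDef; first exact: differentiableZl.
exact: diffZl.
Qed.

Lemma is_diff_coord E p q (f df : E -> 'M[R]_(p, q)) x i j :
  is_diff x f df -> is_diff x (fun z => f z i j) (fun h => df h i j).
Proof.
move=> fdf.
have cl : linear (fun N : 'M[R]_(p, q) => N i j : R^o) by move=> a A B; rewrite !mxE.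
pose cL : {linear 'M[R]_(p, q) -> R^o} :=
  HB.pack (fun N : 'M[R]_(p, q) => N i j : R^o) (GRing.isLinear.Build _ _ _ _ _ cl).
have cc : continuous cL by exact: coord_continuous.
have cd : is_diff (f x) cL cL.
  by apply: DiffDef; [exact: linear_differentiable|exact: diff_lin].
exact: (is_diff_comp fdf cd).
Qed.

Lemma is_diff_mx E p q (f df : E -> 'M[R]_(p, q)) x :
  (forall i j, is_diff x (fun z => f z i j) (fun h => df h i j)) ->
  is_diff x f df.
Proof.
move=> fdf.
have mxE' (g : E -> 'M[R]_(p, q)) :
    g = fun z => \sum_i \sum_j g z i j *: delta_mx i j.
  by apply/funext => z; exact: matrix_sum_delta.
rewrite (mxE' f) (mxE' df).
apply: is_diff_sum => i; apply: is_diff_sum => j; exact: is_diffZl.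
Qed.

(** The product rule for the tangent matrices of composite maps. *)
Lemma is_diff_mulmx E p q r (A dA : E -> 'M[R]_(p, q))
    (B dB : E -> 'M[R]_(q, r)) x :
  is_diff x A dA -> is_diff x B dB ->
  is_diff x (fun z => A z *m B z) (fun h => dA h *m B x + A x *m dB h).
Proof.
move=> AdA BdB; apply: is_diff_mx => i j.
have -> : (fun z => (A z *m B z) i j) = (fun z => \sum_k A z i k * B z k j).
  by apply/funext => z; rewrite !mxE.
have -> : (fun h => (dA h *m B x + A x *m dB h) i j) =
    (fun h => \sum_k (A x i k * dB h k j + B x k j * dA h i k)).
  apply/funext => h; rewrite !mxE -big_split/=; apply: eq_bigr => k _.
  by rewrite addrC [B x k j * _]mulrC.
apply: is_diff_sum => k.
exact: (is_diffM (is_diff_coord i k AdA) (is_diff_coord k j BdB)).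
Qed.

Lemma diff_mulmxl E p q r (A : 'M[R]_(p, q)) (B : E -> 'M[R]_(q, r)) x h :
  differentiable B x -> 'd (fun z => A *m B z) x h = A *m 'd B x h.
Proof.
move=> /differentiableP Bx.
have [_ ->] := is_diff_mulmx (is_diff_cst A x) Bx.
by rewrite /= mul0mx add0r.
Qed.

Lemma differentiable_lin1_mx E p q (L : E -> 'rV[R]_p -> 'rV[R]_q) x :
  (forall u, differentiable (L^~ u) x) ->
  differentiable (fun z => lin1_mx (L z)) x.
Proof.
move=> Lx.
suff [] : is_diff x (fun z => lin1_mx (L z))
  (fun h => \matrix_(i, j) 'd (L^~ (delta_mx 0 i)) x h 0 j) by [].
apply: is_diff_mx => i j.
have -> : (fun z => lin1_mx (L z) i j) = (fun z => L z (delta_mx 0 i) 0 j).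
  by apply/funext => z; rewrite !mxE.
have -> : (fun h => (\matrix_(k, l) 'd (L^~ (delta_mx 0 k)) x h 0 l) i j) =
    (fun h => 'd (L^~ (delta_mx 0 i)) x h 0 j).
  by apply/funext => z; rewrite !mxE.
exact: (is_diff_coord 0 j (differentiableP (Lx _))).
Qed.

Lemma diff_diffC_rV E n (f : E -> 'rV[R]_n) x u v :
  (\forall z \near x, differentiable f z) ->
  differentiable (fun z => 'd f z u) x ->
  differentiable (fun z => 'd f z v) x ->
  'd (fun z => 'd f z u) x v = 'd (fun z => 'd f z v) x u.
Proof.
move=> fx fu fv; apply/rowP => j.
have near_coord w : \forall z \near x, 'd f z w 0 j = 'd (fun y => f y 0 j) z w.
  apply: filterS fx => z /differentiableP fz.
  by have [_ ->] := is_diff_coord 0 j fz.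
have coordw w : differentiable (fun z => 'd f z w) x ->
    is_diff x (fun z => 'd (fun y => f y 0 j) z w)
              (fun h => 'd (fun z => 'd f z w) x h 0 j).
  move=> /differentiableP fw.
  exact: (is_diff_near_eq (near_coord w) (is_diff_coord 0 j fw)).
have [du duE] := coordw u fu; have [dv dvE] := coordw v fv.
have := congr1 (@^~ v) duE => /= <-; have := congr1 (@^~ u) dvE => /= <-.
apply: diff_diffC => //.
by apply: filterS fx => z /differentiableP fz; have [] := is_diff_coord 0 j fz.
Qed.

End Analysis.

(** * Charts and local representatives of smooth maps *)

Section Charts.
Context {R : realType}.
Implicit Types E F : normedModType R.
Implicit Types M N : topologicalType.

Section OneChart.
Context {E : normedModType R} {M : topologicalType} (c : chart E M).
Hypothesis ic : is_chart c.

Lemma chart_inv_map p : chart_dom c p -> chart_inv c (chart_map c p) = p.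
Proof. by move=> cp; apply: (chart_mapK ic); rewrite inE. Qed.

Lemma chart_dom_near p : chart_dom c p -> \near p, chart_dom c p.
Proof. by move=> cp; apply: open_nbhs_nbhs; split => //; exact: chart_dom_open. Qed.

Lemma chart_img_near p : chart_dom c p ->
  \forall s \near chart_map c p,
    chart_dom c (chart_inv c s) /\ chart_map c (chart_inv c s) = s.
Proof.
move=> cp.
have : \forall s \near chart_map c p, chart_img c s.
  apply: open_nbhs_nbhs; split; first exact: chart_img_open.
  by exists p.
by apply: filterS => _ [q cq <-]; rewrite chart_inv_map.
Qed.

Lemma chart_inv_cvg p : chart_dom c p ->
  chart_inv c s @[s --> chart_map c p] --> p.
Proof.
move=> cp; rewrite -[X in _ --> X](chart_inv_map cp).
by apply: (chart_inv_continuous ic); rewrite inE; exists p.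
Qed.

Lemma chart_map_cvg p : chart_dom c p ->
  chart_map c q @[q --> p] --> chart_map c p.
Proof. by move=> cp; apply: (chart_map_continuous ic); rewrite inE. Qed.

End OneChart.

Lemma open_setX M N (A : set M) (B : set N) :
  open A -> open B -> open (A `*` B).
Proof.
by rewrite !openE => oA oB [x y] [/= /oA Ax /oB By]; exists (A, B).
Qed.

Lemma is_chart_prod E F M N (c : chart E M) (d : chart F N) :
  is_chart c -> is_chart d -> is_chart (prod_chart c d).
Proof.
move=> ic id.
have imgE : chart_img (prod_chart c d) = chart_img c `*` chart_img d.
  apply/seteqP; split=> [_ [[p q] [/= cp dq] <-]|[_ _] [/= [p cp <-] [q dq <-]]].
    by split; [exists p|exists q].
  by exists (p, q).
split.
- by apply: open_setX; exact: chart_dom_open.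
- by rewrite imgE; apply: open_setX; exact: chart_img_open.
- by move=> [p q]; rewrite inE => -[/= cp dq]; rewrite /= !chart_inv_map.
- move=> [p q]; rewrite inE => -[/= cp dq].
  apply: cvg_pair => /=.
    by apply: (cvg_comp _ _ cvg_fst); exact: chart_map_cvg.
  by apply: (cvg_comp _ _ cvg_snd); exact: chart_map_cvg.
- move=> [a b]; rewrite inE imgE => -[/= [p cp pa] [q dq qb]].
  rewrite -pa -qb; apply: cvg_pair => /=; rewrite chart_inv_map//.
    by apply: (cvg_comp _ _ cvg_fst); exact: chart_inv_cvg.
  by apply: (cvg_comp _ _ cvg_snd); exact: chart_inv_cvg.
Qed.

Lemma smooth_wrt_near E F M N (A : set (chart E M)) (B : set (chart F N))
    (f : M -> N) c d p :
  smooth_wrt A B f -> A c -> B d -> is_chart c -> is_chart d ->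
  chart_dom c p -> chart_dom d (f p) ->
  \forall s \near chart_map c p, chart_dom d (f (chart_inv c s)).
Proof.
move=> [fc _] Ac Bd ic id cp dfp.
have := cvg_comp _ _ (chart_inv_cvg ic cp) (fc p); apply.
exact: (chart_dom_near id dfp).
Qed.

(** Order 2 is the level at which all the computations below take place: tangent
    maps are first derivatives, and they are differentiated once in the base point. *)
Lemma smooth_wrt_diff E F M N (A : set (chart E M)) (B : set (chart F N))
    (f : M -> N) c d p :
  smooth_wrt A B f -> A c -> B d -> is_chart c -> is_chart d ->
  chart_dom c p -> chart_dom d (f p) ->
  let fh := chart_map d \o f \o chart_inv c in
  (\forall s \near chart_map c p, differentiable fh s) /\
  forall v, differentiable (fun s => 'd fh s v) (chart_map c p).
Proof.
move=> fs Ac Bd ic id cp dfp fh.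
have [_ /(_ c d Ac Bd) /(_ 2) [fh1 fh2]] := fs.
split; last first.
  by move=> v; have [+ _] := fh2 v; apply; exists p.
apply: filterS2 (chart_img_near ic cp) (smooth_wrt_near fs Ac Bd ic id cp dfp).
by move=> s [cs sE] ds; apply: fh1; exists (chart_inv c s).
Qed.

(** Partial derivatives are kept as values of the full differential, so that the
    symmetry of second derivatives applies directly to mixed ones. *)
Lemma is_diff_partial1 E1 E2 F (f : E1 * E2 -> F) s t :
  differentiable f (s, t) ->
  is_diff s (fun s' => f (s', t)) (fun h => 'd f (s, t) (h, 0)).
Proof.
move=> /differentiableP fst.
exact: (is_diff_comp (is_diff_pair (is_diff_id s) (is_diff_cst t s)) fst).
Qed.

Lemma is_diff_partial2 E1 E2 F (f : E1 * E2 -> F) s t :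
  differentiable f (s, t) ->
  is_diff t (fun t' => f (s, t')) (fun h => 'd f (s, t) (0, h)).
Proof.
move=> /differentiableP fst.
exact: (is_diff_comp (is_diff_pair (is_diff_cst s t) (is_diff_id t)) fst).
Qed.

(** Nearness in both variables jointly, used to differentiate in the second
    variable with the first one frozen close to its limit. *)
Lemma near_slice (S T : topologicalType) (P : S * T -> Prop) (a : S) (b : T) :
  (\forall z \near (a, b), P z) ->
  \forall s \near a, \forall t \near b, P (s, t).
Proof.
move=> [[U V] [/= Ua Vb] UVP].
by apply: filterS Ua => s Us; apply: filterS Vb => t Vt; exact: UVP.
Qed.

Implicit Types m n p : nat.

Section Manifolds.
Context {m n p : nat}.
Variables (M : manifoldType R m) (N : manifoldType R n) (P : manifoldType R p).

Lemma is_chart_at (x : M) : is_chart (chart_at x).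
Proof. exact: (atlas_chart _ (chart_at_atlas x)). Qed.

Lemma transition_diff (c c' : chart 'rV[R]_m M) (x : M) :
  atlas c -> atlas c' -> chart_dom c x -> chart_dom c' x ->
  differentiable (chart_map c' \o chart_inv c) (chart_map c x).
Proof.
by move=> ac ac' cx c'x; have [+ _] := atlas_compatible _ _ ac ac' 1; apply; exists x.
Qed.

Lemma smooth2_diff (f : M -> N -> P) (c : chart 'rV[R]_m M)
    (c' : chart 'rV[R]_n N) (d : chart 'rV[R]_p P) (x : M) (y : N) :
  smooth2 f -> atlas c -> atlas c' -> atlas d ->
  chart_dom c x -> chart_dom c' y -> chart_dom d (f x y) ->
  let z0 := (chart_map c x, chart_map c' y) in
  let fh := fun z => chart_map d (f (chart_inv c z.1) (chart_inv c' z.2)) in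
  [/\ \forall z \near z0, differentiable fh z,
      forall v, differentiable (fun z => 'd fh z v) z0 &
      \forall z \near z0, chart_dom d (f (chart_inv c z.1) (chart_inv c' z.2))].
Proof.
move=> fs ac ac' ad cx c'y dxy z0 fh.
have ic := is_chart_prod (atlas_chart _ ac) (atlas_chart _ ac').
have id := atlas_chart _ ad.
have Ac : prod_atlas (@atlas R m M) (@atlas R n N) (prod_chart c c').
  by exists c, c'.
have cxy : chart_dom (prod_chart c c') (x, y) by [].
have [h1 h2] := smooth_wrt_diff fs Ac ad ic id cxy dxy.
split => //.
exact: smooth_wrt_near fs Ac ad ic id cxy dxy.
Qed.

End Manifolds.
End Charts.

(** * Lie groups in the charts at the units *)

Section Coordinates.
Context {R : realType}.
Implicit Types m n p : nat.

Local Notation c1 G := (chart_at (1%g : G)).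
Local Notation e1 G := (at_coord (1%g : G)).

(** The reading of f in the charts at the units; it represents f near the unit
    only when f preserves the unit, an assumption of the lemmas below. *)
Definition coord1 m n (G : lieGroupType R m) (H : lieGroupType R n)
    (f : G -> H) : 'rV[R]_m -> 'rV[R]_n :=
  fun s => chart_map (c1 H) (f (chart_inv (c1 G) s)).

Definition coord2 m n p (G : lieGroupType R m) (H : lieGroupType R n)
    (K : lieGroupType R p) (f : G -> H -> K) : 'rV[R]_m * 'rV[R]_n -> 'rV[R]_p :=
  fun z => chart_map (c1 K) (f (chart_inv (c1 G) z.1) (chart_inv (c1 H) z.2)).

Section Unit.
Context {n : nat} (G : lieGroupType R n).

Lemma unit_chart_dom : chart_dom (c1 G) 1%g.
Proof. exact: chart_at_dom. Qed.

Lemma unit_chart_inv : chart_inv (c1 G) (e1 G) = 1%g.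
Proof.
by rewrite /at_coord chart_inv_map//; [exact: is_chart_at|exact: chart_at_dom].
Qed.

End Unit.

Section OneVariable.
Context {m n : nat} (G : lieGroupType R m) (H : lieGroupType R n) (f : G -> H).
Hypotheses (fs : smooth f) (f1 : f 1%g = 1%g).

Lemma coord1_unit : coord1 f (e1 G) = e1 H.
Proof. by rewrite /coord1 unit_chart_inv f1. Qed.

Lemma coord1_diff : differentiable (coord1 f) (e1 G).
Proof.
have d1 : chart_dom (c1 H) (f 1%g) by rewrite f1; exact: unit_chart_dom.
have [+ _] := smooth_wrt_diff fs (chart_at_atlas _) (chart_at_atlas _)
  (is_chart_at _) (is_chart_at _) (unit_chart_dom G) d1.
by move=> /nbhs_singleton.
Qed.

Lemma coord1_near : \forall s \near e1 G,
  chart_inv (c1 H) (coord1 f s) = f (chart_inv (c1 G) s).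
Proof.
have d1 : chart_dom (c1 H) (f 1%g) by rewrite f1; exact: unit_chart_dom.
have := smooth_wrt_near fs (chart_at_atlas _) (chart_at_atlas _)
  (is_chart_at _) (is_chart_at _) (unit_chart_dom G) d1.
by apply: filterS => s ds; rewrite /coord1 chart_inv_map//; exact: is_chart_at.
Qed.

(** [mdiff] reads its target in the chart at f 1, which is the chart at the unit
    once f 1 = 1. *)
Lemma mdiff_coord1 : mdiff f 1%g = 'd (coord1 f) (e1 G) :> ('rV[R]_m -> 'rV[R]_n).
Proof. by rewrite /mdiff f1. Qed.

End OneVariable.

Section TwoVariables.
Context {m n p : nat} (G : lieGroupType R m) (H : lieGroupType R n).
Context (K : lieGroupType R p) (f : G -> H -> K).
Hypotheses (fs : smooth2 f) (f11 : f 1%g 1%g = 1%g).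

Lemma coord2_unit : coord2 f (e1 G, e1 H) = e1 K.
Proof. by rewrite /coord2 /= !unit_chart_inv f11. Qed.

Let d11 : chart_dom (c1 K) (f 1%g 1%g).
Proof. by rewrite f11; exact: unit_chart_dom. Qed.

Let coord2_facts := smooth2_diff fs (chart_at_atlas _) (chart_at_atlas _)
  (chart_at_atlas _) (unit_chart_dom G) (unit_chart_dom H) d11.

Lemma coord2_diff : \forall z \near (e1 G, e1 H), differentiable (coord2 f) z.
Proof. by have [] := coord2_facts. Qed.

Lemma coord2_diff2 v : differentiable (fun z => 'd (coord2 f) z v) (e1 G, e1 H).
Proof. by have [_ + _] := coord2_facts; apply. Qed.

Lemma coord2_near : \forall z \near (e1 G, e1 H),
  chart_inv (c1 K) (coord2 f z) = f (chart_inv (c1 G) z.1) (chart_inv (c1 H) z.2).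
Proof.
have [_ _] := coord2_facts.
by apply: filterS => z dz; rewrite /coord2 chart_inv_map//; exact: is_chart_at.
Qed.

Lemma coord2_cvg : coord2 f z @[z --> (e1 G, e1 H)] --> e1 K.
Proof.
rewrite -coord2_unit; apply: differentiable_continuous.
exact: (nbhs_singleton coord2_diff).
Qed.

End TwoVariables.

Section Group.
Context {n : nat} (H : lieGroupType R n).
Local Notation mulH := (fun g h : H => (g * h)%g).
Local Notation invH := (fun g : H => g^-1%g).
Local Notation mu := (coord2 mulH).
Local Notation iota := (coord1 invH).
Local Notation e := (e1 H).

Lemma mul_smooth2 : smooth2 mulH. Proof. exact: mulg_smooth. Qed.
Lemma inv_smooth1 : smooth invH. Proof. exact: invg_smooth. Qed.
Lemma mul_unit : mulH 1%g 1%g = 1%g. Proof. exact: mulg1. Qed.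
Lemma inv_unit : invH 1%g = 1%g. Proof. exact: invg1. Qed.

Lemma coord_chartK : \forall s \near e, chart_map (c1 H) (chart_inv (c1 H) s) = s.
Proof.
have := chart_img_near (is_chart_at (1%g : H)) (unit_chart_dom H).
by apply: filterS => s [].
Qed.

Lemma coord_mul1 : \forall s \near e, mu (s, e) = s.
Proof.
by apply: filterS coord_chartK => s; rewrite /coord2 /= unit_chart_inv mulg1.
Qed.

Lemma coord_1mul : \forall s \near e, mu (e, s) = s.
Proof.
by apply: filterS coord_chartK => s; rewrite /coord2 /= unit_chart_inv mul1g.
Qed.

(** The identity is the derivative of mu(s, e) = s. It holds for all s near e,
    not only at e, because it is differentiated once more below. *)
Lemma diff_mul_partial1 : \forall s \near e, forall u, 'd mu (s, e) (u, 0) = u.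
Proof.
have dmu := near_slice (coord2_diff mul_smooth2 mul_unit).
near=> s => u.
have dse : differentiable mu (s, e).
  have : \forall t \near e, differentiable mu (s, t) by near: s.
  exact: nbhs_singleton.
have near_id : \forall t \near s, mu (t, e) = id t.
  near: s.
  have /nbhs_interior := coord_mul1.
  by apply: filterS.
have [_ dE] := is_diff_near_eq near_id (is_diff_partial1 dse).
have [_ idE] := is_diff_id s.
by have := congr1 (@^~ u) dE; rewrite idE /= => <-.
Unshelve. all: by end_near. Qed.

Lemma diff_mul_partial2 u : 'd mu (e, e) (0, u) = u.
Proof.
have dee := nbhs_singleton (coord2_diff mul_smooth2 mul_unit).
have [_ dE] := is_diff_near_eq coord_1mul (is_diff_partial2 dee).
have [_ idE] := is_diff_id e.
by have := congr1 (@^~ u) dE; rewrite idE /= => <-.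
Qed.

Lemma diff_mul_unit v w : 'd mu (e, e) (v, w) = v + w.
Proof.
have -> : (v, w) = (v, 0) + (0, w) :> 'rV[R]_n * 'rV[R]_n.
  by congr pair; rewrite ?addr0 ?add0r.
rewrite linearD; congr (_ + _); last exact: diff_mul_partial2.
exact: (nbhs_singleton diff_mul_partial1).
Qed.

(** Differentiate mu(s, iota s) = e at s = e. *)
Lemma diff_inv_unit v : 'd iota e v = - v.
Proof.
have iE := coord1_unit inv_unit.
have di := differentiableP (coord1_diff inv_smooth1 inv_unit).
have dee : differentiable mu (e, iota e).
  by rewrite iE; exact: (nbhs_singleton (coord2_diff mul_smooth2 mul_unit)).
have dc := is_diff_comp (is_diff_pair (is_diff_id e) di) (differentiableP dee).
have cst_near : \forall s \near e, (mu \o (fun s => (s, iota s))) s = cst e s.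
  apply: filterS (coord1_near inv_smooth1 inv_unit) => s.
  by rewrite /= /coord2 /= => ->; rewrite mulgV.
have [_ dE] := is_diff_near_eq cst_near dc.
have [_ cE] := is_diff_cst e e.
have h : 0 = 'd mu (e, iota e) (v, 'd iota e v).
  exact: etrans (esym (congr1 (@^~ v) cE)) (congr1 (@^~ v) dE).
rewrite iE diff_mul_unit in h.
by apply/eqP; rewrite -addr_eq0 addrC -h.
Qed.

(** The value at q of a left invariant field is written in the chart at q, and
    [vf_coord] transports it to the chart at 1. By the chain rule the detour
    through the chart at q cancels, leaving left multiplication by q read in the
    chart at 1. *)
Lemma left_invariant_coord x : \forall s \near e,
  vf_coord (left_invariant_field H x) 1%g s = 'd mu (s, e) (0, x).
Proof.
have := chart_img_near (is_chart_at (1%g : H)) (unit_chart_dom H).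
have := near_slice (coord2_diff mul_smooth2 mul_unit).
apply: filterS2 => s /nbhs_singleton dse [cq qE].
rewrite /vf_coord /=; set q := chart_inv (c1 H) s in cq qE *.
rewrite /left_invariant_field /mdiff /vdiff mulg1.
have dq1 : chart_dom (chart_at q) (q * 1)%g by rewrite mulg1; exact: chart_at_dom.
have [/near_slice/nbhs_singleton lsm _ ldom] := smooth2_diff mul_smooth2
  (chart_at_atlas q) (chart_at_atlas 1%g) (chart_at_atlas q)
  (chart_at_dom q) (unit_chart_dom H) dq1.
have ldiff := is_diff_partial2 (nbhs_singleton lsm).
have ldom' := nbhs_singleton (near_slice ldom).
have qK : chart_inv (chart_at q) (chart_map (chart_at q) q) = q.
  by rewrite chart_inv_map//; [exact: is_chart_at|exact: chart_at_dom].
rewrite /= qK in ldiff ldom'.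
(* l is left multiplication by q, from the chart at 1 to the chart at q. *)
set l := fun t => _ in ldiff.
have l1 : chart_map (chart_at q) q = l e.
  by rewrite /l unit_chart_inv mulg1.
have tdiff := transition_diff (chart_at_atlas q) (chart_at_atlas 1%g)
  (chart_at_dom q) cq.
have ldiff1 : differentiable l e by case: ldiff.
rewrite l1 in tdiff.
have eq_near : \forall t \near e, ((chart_map (c1 H) \o chart_inv (chart_at q)) \o l) t
    = mu (s, t).
  apply: filterS ldom' => t dt.
  by rewrite /l /= chart_inv_map//; exact: is_chart_at.
have E1 := diff_near_eq eq_near (differentiable_comp ldiff1 tdiff).
have [_ E2] := is_diff_partial2 dse.
have E3 := congr1 (@^~ x) (diff_comp ldiff1 tdiff).
rewrite (l1 : at_coord q = l e).
exact: etrans (esym E3) (etrans (esym (congr1 (@^~ x) E1)) (congr1 (@^~ x) E2)).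
Qed.

Lemma diff_slice v :
  is_diff e (fun s => 'd mu (s, e) v)
    (fun h => 'd (fun z => 'd mu z v) (e, e) (h, 0)).
Proof.
have := coord2_diff2 mul_smooth2 mul_unit v.
exact: (@is_diff_partial1 _ _ _ _ (fun z => 'd mu z v)).
Qed.

(** Near the unit both fields have known expressions in the chart at 1, with values
    y and u at e itself, so their commutator is a difference of two second
    derivatives of mu. *)
Lemma lie_bracket_coord y u : lie_bracket H y u =
  'd (fun z => 'd mu z (0, u)) (e, e) (y, 0)
  - 'd (fun z => 'd mu z (0, y)) (e, e) (u, 0).
Proof.
have fieldE x := left_invariant_coord x.
have field1 x : vf_coord (left_invariant_field H x) 1%g e = x.
  by rewrite (nbhs_singleton (fieldE x)) diff_mul_partial2.
have dfield x v : 'd (vf_coord (left_invariant_field H x) 1%g) e v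
    = 'd (fun z => 'd mu z (0, x)) (e, e) (v, 0).
  have near_eq : \forall s \near e, 'd mu (s, e) (0, x)
      = vf_coord (left_invariant_field H x) 1%g s.
    by apply: filterS (fieldE x) => s ->.
  have [_ E] := is_diff_near_eq near_eq (diff_slice (0, x)).
  have Ev := congr1 (fun g : 'rV[R]_n -> 'rV[R]_n => g v) E.
  exact: Ev.
rewrite /lie_bracket /vf_bracket.
rewrite (field1 y) (field1 u).
exact: (f_equal2 (fun v w : 'rV[R]_n => v - w) (dfield u y) (dfield y u)).
Qed.

End Group.
End Coordinates.

(** * Differentiating the derived action *)

Section Action.
Context {R : realType}.
Local Notation c1 G := (chart_at (1%g : G)).
Local Notation e1 G := (at_coord (1%g : G)).

Lemma mul_rV_lin1_fun p q (L : 'rV[R]_p -> 'rV[R]_q) u :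
  linear L -> u *m lin1_mx L = L u.
Proof.
move=> Llin.
pose L' : {linear 'rV[R]_p -> 'rV[R]_q} :=
  HB.pack L (GRing.isLinear.Build _ _ _ _ _ Llin).
exact: (mul_rV_lin1 L').
Qed.

Lemma lin1_mx_comp p q r (L : 'rV[R]_p -> 'rV[R]_q) (L' : 'rV[R]_q -> 'rV[R]_r) :
  linear L' -> lin1_mx (L' \o L) = lin1_mx L *m lin1_mx L'.
Proof.
move=> Llin; apply/row_matrixP => i; rewrite row_mul.
have rowlin s (K : 'rV[R]_p -> 'rV[R]_s) : row i (lin1_mx K) = K (delta_mx 0 i).
  by apply/rowP => j; rewrite !mxE.
by rewrite !rowlin mul_rV_lin1_fun.
Qed.

Lemma lin1_mx_id p (L : 'rV[R]_p -> 'rV[R]_p) : L =1 id -> lin1_mx L = 1%:M.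
Proof. by move=> Lid; apply/matrixP => i j; rewrite !mxE Lid !mxE eqxx eq_sym. Qed.

Lemma diff_partial_linear1 (E1 E2 F : normedModType R) (f : E1 * E2 -> F) z :
  linear (fun v => 'd f z (v, 0)).
Proof.
move=> a v w; rewrite -linearP; congr ('d f z _).
by congr pair; rewrite /= scaler0 addr0.
Qed.

Lemma diff_partial_linear2 (E1 E2 F : normedModType R) (f : E1 * E2 -> F) z :
  linear (fun v => 'd f z (0, v)).
Proof.
move=> a v w; rewrite -linearP; congr ('d f z _).
by congr pair; rewrite /= scaler0 addr0.
Qed.

Context {m n : nat} (G : lieGroupType R m) (H : lieGroupType R n).
Local Notation eG := (e1 G).
Local Notation eH := (e1 H).
Local Notation mulH := (fun g h : H => (g * h)%g).
Local Notation invH := (fun g : H => g^-1%g).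
Local Notation mu := (coord2 mulH).
Local Notation iota := (coord1 invH).

Lemma diff_action_coord (Psi : G -> H -> H) (T : 'rV[R]_m -> 'M[R]_n) x u :
  (\forall s \near eG, T s = tangent_action Psi (chart_inv (c1 G) s)) ->
  differentiable T eG -> diff_action Psi x u = u *m 'd T eG x.
Proof.
move=> nearT dT; rewrite /diff_action /vdiff.
have E := diff_near_eq nearT dT.
exact: (congr1 (fun g : 'rV[R]_m -> 'M[R]_n => u *m g x) E).
Qed.

Section OneAction.
Variable Psi : G -> H -> H.
Hypotheses (Psis : smooth2 Psi) (Psi1 : forall g, Psi g 1%g = 1%g).

(** The tangent matrix of Psi g at the unit as a partial differential of the local
    representative of Psi, with s the coordinate of g. *)
Definition coord_tangent (s : 'rV[R]_m) : 'M[R]_n :=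
  lin1_mx (fun u => 'd (coord2 Psi) (s, eH) (0, u)).

(** As each Psi g fixes the unit, all its tangent maps at the unit are read in one
    and the same chart. *)
Lemma tangent_action_coord : \forall s \near eG,
  coord_tangent s = tangent_action Psi (chart_inv (c1 G) s).
Proof.
have := near_slice (coord2_diff Psis (Psi1 _)).
apply: filterS => s /nbhs_singleton dPsi.
rewrite /coord_tangent /tangent_action /mdiff Psi1; congr lin1_mx.
by have [_ <-] := is_diff_partial2 dPsi.
Qed.

Lemma coord_tangent_diff : differentiable coord_tangent eG.
Proof.
apply: differentiable_lin1_mx => u.
have d2 := coord2_diff2 Psis (Psi1 _) (0, u).
by have [] := @is_diff_partial1 _ _ _ _ (fun z => 'd (coord2 Psi) z (0, u)) _ _ d2.
Qed.

Lemma coord_tangent_unit (Psi11 : forall h, Psi 1%g h = h) :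
  coord_tangent eG = 1%:M.
Proof.
apply: lin1_mx_id => u.
have dPsi := nbhs_singleton (coord2_diff Psis (Psi1 _)).
have near_id : \forall s \near eH, coord2 Psi (eG, s) = id s.
  apply: filterS (coord_chartK H) => s.
  by rewrite /coord2 /= unit_chart_inv Psi11.
have [_ dE] := is_diff_near_eq near_id (is_diff_partial2 dPsi).
have [_ idE] := is_diff_id eH.
by have := congr1 (@^~ u) dE; rewrite idE /= => <-.
Qed.

End OneAction.

Variables (Phi : G -> H -> H) (D : G -> H).
Hypotheses (hPhi : lie_action Phi) (hD : crossed_hom Phi D).

Let Phis : smooth2 Phi := lie_action_smooth hPhi.
Let Ds : smooth D := hD.1.

Lemma lie_action_unit g : Phi g 1%g = 1%g.
Proof.
have [PhiM _ _] := lie_action_aut hPhi g.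
by apply: (@mulgI H (Phi g 1%g)); rewrite -PhiM !mulg1.
Qed.

Lemma crossed_hom_unit : D 1%g = 1%g.
Proof.
(* D(1) = D(1) Phi(1)(D(1)) = D(1) D(1). *)
have [_ DM] := hD; apply: (@mulgI H (D 1%g)).
by rewrite -{2}(lie_action1 hPhi (D 1%g)) -DM !mulg1.
Qed.

Local Notation delta := (coord1 D).
Let delta1 : delta eG = eH := coord1_unit crossed_hom_unit.
Let ddelta := coord1_diff Ds crossed_hom_unit.

Lemma mdiff_derived_crossed_hom x :
  mdiff (derived_crossed_hom D) 1%g x = - mdiff D 1%g x.
Proof.
have D'1 : derived_crossed_hom D 1%g = 1%g.
  by rewrite /derived_crossed_hom crossed_hom_unit invg1.
rewrite (mdiff_coord1 D'1) (mdiff_coord1 crossed_hom_unit).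
have near_comp : \forall s \near eG,
    (iota \o delta) s = coord1 (derived_crossed_hom D) s.
  apply: filterS (coord1_near Ds crossed_hom_unit) => s Ds'.
  by rewrite /= /coord1 /= Ds'.
have diota : differentiable iota (delta eG).
  by rewrite delta1; exact: coord1_diff (@inv_smooth1 _ _ H) (inv_unit H).
have E := diff_near_eq near_comp (differentiable_comp ddelta diota).
have Ex := congr1 (fun g : 'rV[R]_m -> 'rV[R]_n => g x) E.
have Cx := congr1 (fun g : 'rV[R]_m -> 'rV[R]_n => g x) (diff_comp ddelta diota).
apply: (etrans Ex); apply: (etrans Cx); rewrite /= delta1.
exact: diff_inv_unit.
Qed.

Let dmu := coord2_diff (@mul_smooth2 _ _ H) (mul_unit H).
Let iota1 : iota eH = eH := coord1_unit (inv_unit H).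
Let diota := coord1_diff (@inv_smooth1 _ _ H) (inv_unit H).

Lemma derived_action_unit g : derived_action Phi D g 1%g = 1%g.
Proof. by rewrite /derived_action lie_action_unit mulg1 mulgV. Qed.

(** Differential at the unit of left multiplication by D g, for g near the unit
    and with coordinate s. *)
Definition left_tangent (s : 'rV[R]_m) : 'M[R]_n :=
  lin1_mx (fun w => 'd mu (delta s, eH) (0, w)).

(** Differential at D g of right multiplication by the inverse of D g, for g near
    the unit and with coordinate s. *)
Definition right_tangent (s : 'rV[R]_m) : 'M[R]_n :=
  lin1_mx (fun w => 'd mu (delta s, iota (delta s)) (w, 0)).

Lemma left_path_diff : is_diff eG (fun s => (delta s, eH))
  (fun x => ('d delta eG x, 0)).
Proof. exact: (is_diff_pair (differentiableP ddelta) (is_diff_cst eH eG)). Qed.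

Lemma right_path_diff : is_diff eG (fun s => (delta s, iota (delta s)))
  (fun x => ('d delta eG x, - 'd delta eG x)).
Proof.
have di : is_diff (delta eG) iota (fun v => - v).
  rewrite delta1; have [d_ dE] := differentiableP diota.
  apply: DiffDef; first exact: diota.
  by apply/funext => v; exact: diff_inv_unit.
exact: (is_diff_pair (differentiableP ddelta)
  (is_diff_comp (differentiableP ddelta) di)).
Qed.

Lemma left_tangent_partial_diff w : is_diff eG
  (fun s => 'd mu (delta s, eH) (0, w))
  (fun x => 'd (fun z => 'd mu z (0, w)) (eH, eH) ('d delta eG x, 0)).
Proof.
have d2 := coord2_diff2 (@mul_smooth2 _ _ H) (mul_unit H) (0, w).
have d2' : is_diff (delta eG, eH) (fun z => 'd mu z (0, w))
    ('d (fun z => 'd mu z (0, w)) (eH, eH)).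
  by rewrite delta1; exact: differentiableP.
exact: (is_diff_comp left_path_diff d2').
Qed.

Lemma right_tangent_partial_diff w : is_diff eG
  (fun s => 'd mu (delta s, iota (delta s)) (w, 0))
  (fun x => 'd (fun z => 'd mu z (w, 0)) (eH, eH)
              ('d delta eG x, - 'd delta eG x)).
Proof.
have d2 := coord2_diff2 (@mul_smooth2 _ _ H) (mul_unit H) (w, 0).
have d2' : is_diff (delta eG, iota (delta eG)) (fun z => 'd mu z (w, 0))
    ('d (fun z => 'd mu z (w, 0)) (eH, eH)).
  by rewrite delta1 iota1; exact: differentiableP.
exact: (is_diff_comp right_path_diff d2').
Qed.

(** The charts may be cancelled between two factors only where the intermediate
    products stay in the chart domain, hence only near the units. *)
Lemma derived_action_coord : \forall z \near (eG, eH),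
  mu (mu (delta z.1, coord2 Phi z), iota (delta z.1)) =
  chart_map (c1 H) (derived_action Phi D (chart_inv (c1 G) z.1) (chart_inv (c1 H) z.2)).
Proof.
have cvg1 : delta z.1 @[z --> (eG, eH)] --> eH.
  have dcvg : delta s @[s --> eG] --> delta eG.
    exact: differentiable_continuous ddelta.
  rewrite delta1 in dcvg.
  have fcvg : z.1 @[z --> (eG, eH)] --> eG by exact: cvg_fst.
  exact: (cvg_comp _ _ fcvg dcvg).
have cvg2 := coord2_cvg Phis (lie_action_unit 1%g).
have cvg12 : (delta z.1, coord2 Phi z) @[z --> (eG, eH)] --> (eH, eH).
  exact: (cvg_pair cvg1 cvg2).
have nearD : \forall z \near (eG, eH),
    chart_inv (c1 H) (delta z.1) = D (chart_inv (c1 G) z.1).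
  have fcvg : z.1 @[z --> (eG, eH)] --> eG by exact: cvg_fst.
  exact: (fcvg _ (coord1_near Ds crossed_hom_unit)).
have nearPhi := coord2_near Phis (lie_action_unit 1%g).
have nearmu := cvg12 _ (coord2_near (@mul_smooth2 _ _ H) (mul_unit H)).
have neari := cvg1 _ (coord1_near (@inv_smooth1 _ _ H) (inv_unit H)).
near=> z.
have zD : chart_inv (c1 H) (delta z.1) = D (chart_inv (c1 G) z.1) by near: z.
have zPhi : chart_inv (c1 H) (coord2 Phi z) =
  Phi (chart_inv (c1 G) z.1) (chart_inv (c1 H) z.2) by near: z.
have zmu : chart_inv (c1 H) (mu (delta z.1, coord2 Phi z)) =
  (chart_inv (c1 H) (delta z.1) * chart_inv (c1 H) (coord2 Phi z))%g by near: z.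
have zi : chart_inv (c1 H) (iota (delta z.1)) =
  (chart_inv (c1 H) (delta z.1))^-1%g by near: z.
rewrite {1}/coord2; cbn [fst snd].
by rewrite zmu zi zD zPhi.
Unshelve. all: by end_near. Qed.

(** Chain rule in t for mu(mu(delta s, Phi(s, t)), iota(delta s)) at t = e. The
    factors appear in the order in which the maps are applied, since matrices act
    on row vectors from the right. *)
Lemma derived_action_tangent : \forall s \near eG,
  coord_tangent Phi s *m left_tangent s *m right_tangent s
  = tangent_action (derived_action Phi D) (chart_inv (c1 G) s).
Proof.
have nearE := near_slice derived_action_coord.
have nearPhi := near_slice (coord2_diff Phis (lie_action_unit 1%g)).
have nearl : \forall s \near eG, differentiable mu (delta s, eH).
  have lcvg : (delta s, eH) @[s --> eG] --> (delta eG, eH).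
    by have [dl _] := left_path_diff; exact: differentiable_continuous dl.
  by rewrite delta1 in lcvg; exact: (lcvg _ dmu).
have nearr : \forall s \near eG, differentiable mu (delta s, iota (delta s)).
  have rcvg : (delta s, iota (delta s)) @[s --> eG] --> (delta eG, iota (delta eG)).
    by have [dr _] := right_path_diff; exact: differentiable_continuous dr.
  by rewrite delta1 iota1 in rcvg; exact: (rcvg _ dmu).
have nearm : \forall s \near eG, mu (delta s, eH) = delta s.
  have dcvg : delta s @[s --> eG] --> delta eG.
    exact: differentiable_continuous ddelta.
  by rewrite delta1 in dcvg; exact: (dcvg _ (coord_mul1 H)).
near=> s.
have sE : \forall t \near eH,
    mu (mu (delta s, coord2 Phi (s, t)), iota (delta s)) =
    chart_map (c1 H) (derived_action Phi D (chart_inv (c1 G) s) (chart_inv (c1 H) t)).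
  by near: s.
have sPhi : differentiable (coord2 Phi) (s, eH).
  have : \forall t \near eH, differentiable (coord2 Phi) (s, t) by near: s.
  exact: nbhs_singleton.
have sl : differentiable mu (delta s, eH).
  near: s; exact: nearl.
have sr : differentiable mu (delta s, iota (delta s)).
  near: s; exact: nearr.
have sm : mu (delta s, eH) = delta s by near: s.
have Phie : coord2 Phi (s, eH) = eH.
  by rewrite /coord2 /= unit_chart_inv lie_action_unit.
have d1 := is_diff_partial2 sPhi.
have d2 : is_diff (coord2 Phi (s, eH)) (fun t => mu (delta s, t))
    (fun h => 'd mu (delta s, eH) (0, h)).
  rewrite Phie; exact: is_diff_partial2.
have d12 := is_diff_comp d1 d2.
have d3 : is_diff (((fun t => mu (delta s, t)) \o (fun t => coord2 Phi (s, t))) eH)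
    (fun t => mu (t, iota (delta s)))
    (fun h => 'd mu (delta s, iota (delta s)) (h, 0)).
  by rewrite /= Phie sm; exact: is_diff_partial1.
have [_ dE] := is_diff_near_eq sE (is_diff_comp d12 d3).
rewrite -lin1_mx_comp; last exact: diff_partial_linear2.
rewrite -lin1_mx_comp; last exact: diff_partial_linear1.
by rewrite /tangent_action /mdiff derived_action_unit -dE.
Unshelve. all: by end_near. Qed.

(** By [diff_mul_partial1], the differentiated function is constant near e. *)
Lemma diff_mul_partial1_const w h :
  'd (fun z => 'd mu z (w, 0)) (eH, eH) (h, 0) = 0.
Proof.
have near_cst : \forall s \near eH, 'd mu (s, eH) (w, 0) = cst w s.
  by apply: filterS (diff_mul_partial1 H) => s; apply.
have [_ dE] := is_diff_near_eq near_cst (diff_slice H (w, 0)).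
have [_ cE] := is_diff_cst w eH.
have Eh := congr1 (fun g : 'rV[R]_n -> 'rV[R]_n => g h) dE.
have Ch := congr1 (fun g : 'rV[R]_n -> 'rV[R]_n => g h) cE.
exact: etrans (esym Eh) Ch.
Qed.

Lemma diff_mul_mixed u y :
  'd (fun z => 'd mu z (u, 0)) (eH, eH) (0, y) =
  'd (fun z => 'd mu z (0, y)) (eH, eH) (u, 0).
Proof.
apply: diff_diffC_rV; first exact: dmu.
  exact: coord2_diff2 (@mul_smooth2 _ _ H) (mul_unit H) _.
exact: coord2_diff2 (@mul_smooth2 _ _ H) (mul_unit H) _.
Qed.

Lemma left_tangent_unit : left_tangent eG = 1%:M.
Proof. by apply: lin1_mx_id => w; rewrite delta1; exact: diff_mul_partial2. Qed.

Lemma right_tangent_unit : right_tangent eG = 1%:M.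
Proof.
apply: lin1_mx_id => w; rewrite delta1 iota1.
exact: (nbhs_singleton (diff_mul_partial1 H)).
Qed.

Lemma left_tangent_diff : differentiable left_tangent eG.
Proof.
by apply: differentiable_lin1_mx => w; have [] := left_tangent_partial_diff w.
Qed.

Lemma right_tangent_diff : differentiable right_tangent eG.
Proof.
by apply: differentiable_lin1_mx => w; have [] := right_tangent_partial_diff w.
Qed.

Lemma mul_diff_left_tangent u x : u *m 'd left_tangent eG x =
  'd (fun z => 'd mu z (0, u)) (eH, eH) ('d delta eG x, 0).
Proof.
rewrite -(diff_mulmxl u x left_tangent_diff).
have -> : (fun s => u *m left_tangent s) = (fun s => 'd mu (delta s, eH) (0, u)).
  by apply/funext => s; rewrite mul_rV_lin1_fun//; exact: diff_partial_linear2.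
have [_ E] := left_tangent_partial_diff u.
have Ex := congr1 (fun g : 'rV[R]_m -> 'rV[R]_n => g x) E.
exact: Ex.
Qed.

Lemma mul_diff_right_tangent u x : u *m 'd right_tangent eG x =
  'd (fun z => 'd mu z (u, 0)) (eH, eH) ('d delta eG x, - 'd delta eG x).
Proof.
rewrite -(diff_mulmxl u x right_tangent_diff).
have -> : (fun s => u *m right_tangent s) =
    (fun s => 'd mu (delta s, iota (delta s)) (u, 0)).
  by apply/funext => s; rewrite mul_rV_lin1_fun//; exact: diff_partial_linear1.
have [_ E] := right_tangent_partial_diff u.
have Ex := congr1 (fun g : 'rV[R]_m -> 'rV[R]_n => g x) E.
exact: Ex.
Qed.

Lemma diff_mul_antidiagonal u y :
  'd (fun z => 'd mu z (u, 0)) (eH, eH) (y, - y) =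
  - 'd (fun z => 'd mu z (0, y)) (eH, eH) (u, 0).
Proof.
have -> : (y, - y) = (y, 0) - (0, y) :> 'rV[R]_n * 'rV[R]_n.
  by congr pair; rewrite /= ?subr0 ?sub0r.
apply: (etrans (linearB _ _ _)).
apply: (etrans (f_equal2 (fun v w : 'rV[R]_n => v - w)
  (diff_mul_partial1_const u y) (diff_mul_mixed u y))).
exact: sub0r.
Qed.

(** The differential of Ad is ad: the left-hand side is the derivative at 1 of
    Ad(D g) u along x, split into its two one-sided multiplications. *)
Lemma ad_eq_lie_bracket u x :
  u *m 'd left_tangent eG x + u *m 'd right_tangent eG x =
  lie_bracket H ('d delta eG x) u.
Proof.
apply: (etrans (f_equal2 (fun v w : 'rV[R]_n => v + w)
  (mul_diff_left_tangent u x) (mul_diff_right_tangent u x))).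
apply: (etrans _ (esym (lie_bracket_coord H ('d delta eG x) u))).
exact: (f_equal2 (fun v w : 'rV[R]_n => v + w) erefl (diff_mul_antidiagonal u _)).
Qed.

(** All three tangent matrices are the identity at the unit, so the product rule
    leaves the sum of their derivatives. *)
Lemma diff_derived_action x u :
  diff_action (derived_action Phi D) x u =
  diff_action Phi x u + lie_bracket H (mdiff D 1%g x) u.
Proof.
have dT := coord_tangent_diff Phis lie_action_unit.
have dTPQ := is_diff_mulmx (is_diff_mulmx (differentiableP dT)
  (differentiableP left_tangent_diff)) (differentiableP right_tangent_diff).
have [dprod dE] := dTPQ.
have -> := diff_action_coord x u derived_action_tangent dprod.
have -> := diff_action_coord x u (tangent_action_coord Phis lie_action_unit) dT.
have Ex := congr1 (fun g : 'rV[R]_m -> 'M[R]_n => u *m g x) dE.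
apply: (etrans Ex).
rewrite (coord_tangent_unit Phis lie_action_unit (lie_action1 hPhi)).
rewrite left_tangent_unit right_tangent_unit !mul1mx !mulmx1 !mulmxDr -addrA.
rewrite (mdiff_coord1 crossed_hom_unit).
exact: (f_equal2 (fun v w : 'rV[R]_n => v + w) erefl (ad_eq_lie_bracket u x)).
Qed.

End Action.

Theorem theorem4p2 (R : realType) (m n : nat)
    (G : lieGroupType R m) (H : lieGroupType R n)
    (Phi : G -> H -> H) (D : G -> H)
    (hPhi : lie_action Phi) (hD : crossed_hom Phi D) :
  let phi := diff_action Phi in
  let d := mdiff D 1%g in
  diff_action (derived_action Phi D) = derived_lie_action H phi d /\
  mdiff (derived_crossed_hom D) 1%g = derived_lie_crossed_hom d.
Proof.
move=> phi d; split.
  by apply/funext => x; apply/funext => u; exact: diff_derived_action.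
by apply/funext => x; exact: mdiff_derived_crossed_hom hPhi hD x.
Qed.
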